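(* Let $p$ be an odd prime and $a$ be a positive integer. Then $$ \sum_{k=0}^{p-1}(-1)^{(a-1)k}\binom{p-1}{k}^a\equiv 2^{a(p-1)}+\frac{a(a-1)(3a-4)}{48}\,p^3B_{p-3}\pmod{p^4}. $$
   Context: $B_n$ denotes the $n$-th Bernoulli number, defined by $\frac{t}{e^t-1}=\sum_{n=0}^{\infty}\frac{B_n}{n!}t^n$. Congruences between rational numbers are understood for rationals whose denominators are coprime to $p$: $x\equiv y\pmod{p^4}$ means $x-y=p^4 r$ with $r$ a rational number whose denominator is not divisible by $p$. *)

(* Defs.v *)
From mathcomp Require Import all_boot all_order all_algebra.
Set Implicit Arguments. Unset Strict Implicit. Unset Printing Implicit Defensive.
Import Order.TTheory GRing.Theory Num.Theory.
Local Open Scope ring_scope.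

(* Bernoulli numbers via t/(e^t-1) = sum B_n t^n/n!, i.e. B_0 = 1 and
   sum_{k=0}^{n} C(n+1,k) B_k = 0 for n >= 1 (so B_1 = -1/2). *)
Fixpoint bern_seq (n : nat) : seq rat :=
  match n with
  | 0%N => [:: 1]
  | m.+1 =>
      let s := bern_seq m in
      rcons s (- (\sum_(k < m.+1) ('C(m.+2, k))%:R * nth 0 s k) / (m.+2)%:R)
  end.

Definition bernoulli (n : nat) : rat := nth 0 (bern_seq n) n.

Definition rat_cong_pow (p e : nat) (x y : rat) : Prop :=
  exists r : rat, coprime p `|denq r|%N /\ x - y = (p ^ e)%:R * r.

(* Main.v *)
Require Import Defs.
From HB Require Import structures.
From mathcomp Require Import all_boot all_order all_algebra.
From mathcomp Require Import ring zify.
Set Implicit Arguments. Unset Strict Implicit. Unset Printing Implicit Defensive.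
Import Order.TTheory GRing.Theory Num.Theory.
Local Open Scope ring_scope.

(* Put x_k = (-1)^k C(p-1,k), the product of the 1 - p/j for 1 <= j <= k, and
   u_k = x_k - 1 = O(p).  The left-hand side is the sum S(a) of the (-1)^k x_k^a,
   and modulo p^4 it is a cubic polynomial in a whose coefficients involve only
   A_i, the sum of the (-1)^k u_k^i, for i <= 3.
   A_1 = w := 2^(p-1) - 1 by the binomial theorem.  A_2 comes from the value
   (-1)^n C(2n,n) = x_n of S(2), where p = 2n + 1.  A_3 comes from the derivative
   S'(0): the alternating sum of log x_k telescopes to log P, where P is the
   product of the 1 - p/(2j) for j <= n.  Moreover x_n = 2^(p-1) P exactly, and
   2 log P - log x_n = p^2/4 (H_2 + p H_3) with H_s the sum of the j^-s for
   j <= n.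
   Comparing the sum over 0 < j < p split as j, p - j and as 2j, p - 2j gives
   H_2 = - (7/6) p H_3 modulo p^2, and the same comparison for the powers j^(p-3)
   gives H_3 = - 2 B_{p-3} modulo p, so 2 log P - log x_n = p^3 B_{p-3} / 12.
   The prime 3, at which the truncated logarithm is unavailable, is treated
   directly. *)

(** * Rationals integral at p and the ideals generated by powers of p *)

(** Congruences below are proved by exhibiting an explicit combination of known members of an ideal;
    the equality that remains is left to [ring] or [field]. *)
Lemma mem_by_eq (S : {pred rat}) (x y : rat) : y \in S -> x = y -> x \in S.
Proof. by move=> yS ->. Qed.

(* [pint p] is the localization of the integers at p, [pideal p e] its ideal (p^e). *)
Definition pint (p : nat) : {pred rat} := [pred x | coprime p `|denq x|].

Definition pideal (p e : nat) : {pred rat} := [pred x | x / p%:R ^+ e \in pint p].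

(** Any denominator prime to p will do, not only the reduced one, so closure under sums and products
    follows by multiplying denominators. *)
Lemma pintP (p : nat) (x : rat) :
  reflect (exists d : nat, coprime p d /\ x * d%:R \is a Num.int) (x \in pint p).
Proof.
apply: (iffP idP) => [xp|[d [pd /intrP [z xd]]]].
  exists `|denq x|%N; split=> //.
  rewrite -[X in X * _](divq_num_den x) natr_absz gtr0_norm ?denq_gt0 //.
  by rewrite divfK ?intr_int // intr_eq0 denq_neq0.
rewrite inE; apply: coprime_dvdr pd.
have dn0 : (denq x)%:~R != 0 :> rat by rewrite intr_eq0 denq_neq0.
have : numq x * d = z * denq x.
  apply: (@intr_inj rat); rewrite !rmorphM /= -xd -[X in _ = X * _ * _](divq_num_den x).
  by rewrite -pmulrn; field.
move=> /(congr1 absz); rewrite !abszM absz_nat => E.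
have : (`|denq x| %| `|numq x| * d)%N by rewrite E dvdn_mull.
by rewrite Gauss_dvdr // coprime_sym coprime_num_den.
Qed.

Fact pint_subring_closed (p : nat) : subring_closed (pint p).
Proof.
split.
- by rewrite inE /= coprimen1.
- move=> x y /pintP [d [pd xd]] /pintP [e [pe ye]].
  apply/pintP; exists (d * e)%N; split; first by rewrite coprimeMr pd pe.
  rewrite natrM (_ : _ * _ = x * d%:R * e%:R - y * e%:R * d%:R); last by ring.
  by apply: rpredB; apply: rpredM => //; apply: rpred_nat.
- move=> x y /pintP [d [pd xd]] /pintP [e [pe ye]].
  apply/pintP; exists (d * e)%N; split; first by rewrite coprimeMr pd pe.
  by rewrite natrM mulrACA rpredM.
Qed.

HB.instance Definition _ p :=
  GRing.isSubringClosed.Build rat (pint p) (pint_subring_closed p).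

Fact pideal_zmod_closed (p e : nat) : zmod_closed (pideal p e).
Proof.
split=> [|x y xp yp]; first by rewrite inE mul0r rpred0.
by rewrite inE mulrBl rpredB.
Qed.

HB.instance Definition _ p e :=
  GRing.isZmodClosed.Build rat (pideal p e) (pideal_zmod_closed p e).

Lemma pint_inv_nat (p d : nat) : coprime p d -> d%:R^-1 \in pint p.
Proof.
move=> pd; apply/pintP; exists d; split=> //.
case: d {pd} => [|d]; first by rewrite mulr0.
by rewrite mulVf ?pnatr_eq0.
Qed.

Section PrimeIdeals.

Variables (p : nat) (p_pr : prime p).

Let p_neq0 : p%:R != 0 :> rat.
Proof. by rewrite pnatr_eq0 -lt0n prime_gt0. Qed.

Lemma pideal0 : pideal p 0 =i pint p.
Proof. by move=> x; rewrite inE expr0 divr1. Qed.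

Lemma pideal_self e : p%:R ^+ e \in pideal p e.
Proof. by rewrite inE divff ?rpred1 // expf_neq0. Qed.

Lemma pidealM e f x y : x \in pideal p e -> y \in pideal p f ->
  x * y \in pideal p (e + f).
Proof.
move=> xe yf; rewrite inE.
have -> : x * y / p%:R ^+ (e + f) = x / p%:R ^+ e * (y / p%:R ^+ f).
  by rewrite exprD; field; rewrite !expf_neq0.
exact: rpredM xe yf.
Qed.

Lemma pidealMl e x y : x \in pint p -> y \in pideal p e -> x * y \in pideal p e.
Proof. by rewrite -pideal0 => xp yp; have := pidealM xp yp. Qed.

Lemma pidealMr e x y : x \in pideal p e -> y \in pint p -> x * y \in pideal p e.
Proof. by rewrite mulrC => xp yp; exact: pidealMl. Qed.

Lemma pidealX e k x : x \in pideal p e -> x ^+ k \in pideal p (e * k).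
Proof.
move=> xe; elim: k => [|k IH]; first by rewrite muln0 pideal0 expr0 rpred1.
by rewrite exprS mulnS pidealM.
Qed.

Lemma pideal_le e f x : (e <= f)%N -> x \in pideal p f -> x \in pideal p e.
Proof.
move=> /subnKC <- xf; rewrite inE.
have -> : x / p%:R ^+ e = x / p%:R ^+ (e + (f - e)) * p%:R ^+ (f - e).
  by rewrite exprD; field; rewrite !expf_neq0.
by apply: rpredM xf _; rewrite rpredX ?rpred_nat.
Qed.

Lemma pideal_pint e x : x \in pideal p e -> x \in pint p.
Proof. by rewrite -pideal0; exact: pideal_le. Qed.

Lemma pideal_mulp e x : (p%:R * x \in pideal p e.+1) = (x \in pideal p e).
Proof.
rewrite !inE exprS; congr (_ \in pint p).
by field; rewrite expf_neq0 // p_neq0.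
Qed.

Lemma pint_inv_lt d : (0 < d < p)%N -> d%:R^-1 \in pint p.
Proof.
move=> /andP [d0 dp]; apply: pint_inv_nat; rewrite prime_coprime //.
by rewrite gtnNdvd.
Qed.

Lemma pint_inv2 : (3 < p)%N -> 2^-1 \in pint p.
Proof. by move=> p3; apply: (pint_inv_lt (d := 2)); lia. Qed.

Lemma pint_inv3 : (3 < p)%N -> 3^-1 \in pint p.
Proof. exact: (pint_inv_lt (d := 3)). Qed.

End PrimeIdeals.

Lemma rat_cong_powP (p e : nat) (x y : rat) : prime p ->
  x - y \in pideal p e -> rat_cong_pow p e x y.
Proof.
move=> p_pr xy; exists ((x - y) / p%:R ^+ e); split; first exact: xy.
rewrite natrX mulrC divfK // expf_neq0 //.
by rewrite pnatr_eq0 -lt0n prime_gt0.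
Qed.

(** * Power and logarithm expansions modulo p^4 *)

(** The series of log(1 + u) cut after its cubic term: for u in (p), the laws of the logarithm
    become polynomial identities with an explicit remainder in (p^4). *)
Definition tlog (u : rat) : rat := u - u ^+ 2 / 2 + u ^+ 3 / 3.

Lemma tlog0 : tlog 0 = 0.
Proof. by rewrite /tlog; field. Qed.

Section TruncatedExpansions.

Variables (p : nat) (p_pr : prime p).

(** By Pascal's rule, multiplying the truncation for a by 1 + u gives the one for a + 1 plus the
    single extra term C(a,3) u^4. *)
Lemma expr_trunc3 (u : rat) (a : nat) : u \in pideal p 1 ->
  (1 + u) ^+ a -
    (1 + a%:R * u + ('C(a, 2))%:R * u ^+ 2 + ('C(a, 3))%:R * u ^+ 3)
    \in pideal p 4.
Proof.
move=> u1; have u4 := pidealX p_pr 4 u1.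
have up : 1 + u \in pint p by rewrite rpredD ?rpred1 ?(pideal_pint p_pr u1).
elim: a => [|a IH].
  by rewrite !bin0n expr0 !mul0r !addr0 subrr rpred0.
have Cp : ('C(a, 3))%:R \in pint p by rewrite rpred_nat.
apply: (mem_by_eq (rpredD (pidealMl p_pr up IH) (pidealMl p_pr Cp u4))).
rewrite exprS !binS bin1 !natrD -[a.+1]addn1 natrD.
ring.
Qed.

Hypothesis p_gt3 : (3 < p)%N.

Let inv2 := pint_inv2 p_pr p_gt3.
Let inv3 := pint_inv3 p_pr p_gt3.

(** With s = u + v and t = u v, the difference is exactly t^2 (t/3 + s - 1/2) + s^2 t, where t and
    s^2 lie in (p^2). *)
Lemma tlogM (u v : rat) : u \in pideal p 1 -> v \in pideal p 1 ->
  tlog ((1 + u) * (1 + v) - 1) - (tlog u + tlog v) \in pideal p 4.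
Proof.
move=> u1 v1.
have s1 : u + v \in pideal p 1 by rewrite rpredD.
have t2 := pidealM p_pr u1 v1.
have tt := pidealM p_pr t2 t2.
have c : (u * v) / 3 + (u + v) - 2^-1 \in pint p.
  have [tp sp] := (pideal_pint p_pr t2, pideal_pint p_pr s1).
  by rewrite rpredB // rpredD // rpredM.
apply: (mem_by_eq (rpredD (pidealMr p_pr tt c) (pidealM p_pr (pidealX p_pr 2 s1) t2))).
by rewrite /tlog; field.
Qed.

Lemma tlog_prod (f : nat -> rat) (n : nat) :
  (forall i, (i < n)%N -> f i \in pideal p 1) ->
  \prod_(i < n) (1 + f i) - 1 \in pideal p 1 /\
  tlog (\prod_(i < n) (1 + f i) - 1) - \sum_(i < n) tlog (f i) \in pideal p 4.
Proof.
elim: n => [|n IH] f1.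
  by rewrite !big_ord0 subrr tlog0 subrr !rpred0.
have {}IH := IH (fun i lt_in => f1 i (ltnW lt_in)).
rewrite !big_ord_recr /=; set P := \prod_(i < n) _ in IH *.
set S := \sum_(i < n) _ in IH *; have fn := f1 n (ltnSn n).
have [P1 IHl] := IH; split.
  rewrite (_ : _ - 1 = (P - 1) * (1 + f n) + f n); last by ring.
  rewrite rpredD // pidealMr // rpredD ?rpred1 //.
  exact: pideal_pint fn.
apply: (mem_by_eq (rpredD (tlogM P1 fn) IHl)).
by rewrite (_ : 1 + (P - 1) = P); ring.
Qed.

Lemma tlog_inj (u v : rat) : u \in pideal p 1 -> v \in pideal p 1 ->
  tlog u - tlog v \in pideal p 4 -> u - v \in pideal p 4.
Proof.
move=> u1 v1 uv.
(* The difference of the logarithms is (u - v)(1 + c). Multiplying by 1 - c + c^2 - c^3 leaves (u -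
   v)(1 - c^4), and c^4 lies in (p^4). *)
pose c := - (u + v) / 2 + (u ^+ 2 + u * v + v ^+ 2) / 3.
have c1 : c \in pideal p 1.
  rewrite rpredD //; first by rewrite pidealMr // rpredN rpredD.
  apply: pidealMr => //; apply: (@pideal_le _ p_pr 1 2) => //.
  exact: rpredD (rpredD (pidealX p_pr 2 u1) (pidealM p_pr u1 v1)) (pidealX p_pr 2 v1).
have d : u - v \in pint p by apply: (pideal_pint p_pr (e := 1)); rewrite rpredB.
have cp := pideal_pint p_pr c1.
have g : 1 - c + c ^+ 2 - c ^+ 3 \in pint p.
  exact: rpredB (rpredD (rpredB (rpred1 _) cp) (rpredX 2 cp)) (rpredX 3 cp).
apply: (mem_by_eq (rpredD (pidealMr p_pr uv g) (pidealMl p_pr d (pidealX p_pr 4 c1)))).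
by rewrite /c /tlog; field.
Qed.

End TruncatedExpansions.

(** * Sums over half of the residues, modulo p^2 *)

Section FoldedSums.

Variables (f : nat -> rat) (n : nat).

Lemma sum_reflect :
  \sum_(i < n.*2) f i.+1 = \sum_(i < n) (f i.+1 + f (n.*2.+1 - i.+1)%N).
Proof.
rewrite -addnn big_split_ord big_split /=; congr (_ + _).
rewrite (reindex_inj rev_ord_inj) /=; apply: eq_bigr => i _.
by congr f; have := ltn_ord i; lia.
Qed.

(** An index from 1 to 2n is either some 2j or, being odd, some 2n + 1 - 2j, with 1 <= j <= n. *)
Lemma sum_even_reflect :
  \sum_(i < n.*2) f i.+1 = \sum_(i < n) (f i.+1.*2 + f (n.*2.+1 - i.+1.*2)%N).
Proof.
rewrite big_split /= [X in _ + X](reindex_inj rev_ord_inj) /=.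
rewrite [X in _ + X](eq_bigr (fun i : 'I_n => f i.*2.+1)); last first.
  by move=> i _; congr f; have := ltn_ord i; lia.
elim: n => [|k IH]; first by rewrite !big_ord0 addr0.
by rewrite doubleS !big_ord_recr /= IH; ring.
Qed.

End FoldedSums.

(** The pairings j, p - j and 2j, p - 2j evaluate the same T. Here g is the first-order term of f
    under reflection; as f and g are homogeneous under doubling, both values involve only U and
    V. *)
Lemma half_range_sums (p n : nat) (f g : nat -> rat) (c : rat) :
  prime p -> p = n.*2.+1 ->
  (forall j, (0 < j < p)%N -> f (p - j)%N - (f j + p%:R * g j) \in pideal p 2) ->
  (forall j, f j.*2 = c * f j) -> (forall j, g j.*2 = c / 2 * g j) ->
  let T := \sum_(i < p.-1) f i.+1 in
  let U := \sum_(i < n) f i.+1 in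
  let V := \sum_(i < n) g i.+1 in
  T - (2 * U + p%:R * V) \in pideal p 2 /\
  T - (2 * c * U + c / 2 * (p%:R * V)) \in pideal p 2.
Proof.
move=> p_pr p_n fgp f2 g2 /=; have -> : p.-1 = n.*2 by rewrite p_n.
split.
  rewrite sum_reflect -p_n !mulr_sumr -big_split -sumrB rpred_sum // => i _ /=.
  apply: mem_by_eq (fgp i.+1 _) _; last by ring.
  by have := ltn_ord i; lia.
rewrite sum_even_reflect -p_n !mulr_sumr -big_split -sumrB rpred_sum // => i _ /=.
apply: mem_by_eq (fgp i.+1.*2 _) _; last by rewrite f2 g2; field.
by have := ltn_ord i; lia.
Qed.

Lemma fermat_pideal (p j : nat) : prime p -> (0 < j < p)%N ->
  j%:R ^+ p.-1 - 1 \in pideal p 1.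
Proof.
move=> p_pr jp; have j0 : j%:R != 0 :> rat by rewrite pnatr_eq0; lia.
have j_le : (j <= j ^ p)%N.
  by rewrite -{1}[j]expn1 leq_pexp2l; have := prime_gt0 p_pr; lia.
have : (p %| j ^ p - j)%N.
  by rewrite -eqn_mod_dvd //; apply/eqP; exact: fermat_little.
case/dvdnP=> k E.
have Er : j%:R ^+ p = p%:R * k%:R + j%:R :> rat.
  rewrite -natrX -natrM -natrD mulnC -E subnK // natrX.
have kp : j%:R^-1 * k%:R \in pint p.
  by rewrite rpredM ?rpred_nat ?pint_inv_lt.
apply: (mem_by_eq (pidealMr p_pr (pideal_self p_pr 1) kp)).
apply: (mulfI j0); rewrite mulrBr -exprS prednK ?prime_gt0 // Er.
by field.
Qed.

Lemma expr_sub_pideal (p j m : nat) : prime p ->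
  (j%:R - p%:R) ^+ m.+1 - (j%:R ^+ m.+1 - m.+1%:R * p%:R * j%:R ^+ m)
    \in pideal p 2.
Proof.
move=> p_pr; elim: m => [|m IH].
  by apply: mem_by_eq (rpred0 _) _; ring.
have jp : j%:R - p%:R \in pint p by rewrite rpredB ?rpred_nat.
have c : (m.+1)%:R * j%:R ^+ m \in pint p by rewrite rpredM ?rpredX ?rpred_nat.
apply: (mem_by_eq (rpredD (pidealMl p_pr jp IH)
                          (pidealMr p_pr (pideal_self p_pr 2) c))).
rewrite !exprS -[m.+2]addn1 natrD; ring.
Qed.

(** Fermat's little theorem makes j^(p-4) congruent to j^-3. *)
Lemma half_cubes_pow (p n : nat) : prime p -> (3 < p)%N -> p = n.*2.+1 ->
  \sum_(i < n) i.+1%:R ^+ (p - 4) - \sum_(i < n) i.+1%:R^-1 ^+ 3 \in pideal p 1.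
Proof.
move=> p_pr p3 p_n; rewrite -sumrB rpred_sum // => i _.
have ip : (0 < i.+1 < p)%N by have := ltn_ord i; lia.
have i3 : i.+1%:R^-1 ^+ 3 \in pint p by rewrite rpredX ?pint_inv_lt.
apply: mem_by_eq (pidealMl p_pr i3 (fermat_pideal p_pr ip)) _.
have -> : p.-1 = (p - 4 + 3)%N by lia.
have : i.+1%:R != 0 :> rat by rewrite pnatr_eq0.
by rewrite exprD; move: (i.+1%:R : rat) => x x0; field.
Qed.

Lemma half_squares (p n : nat) : prime p -> (3 < p)%N -> p = n.*2.+1 ->
  \sum_(i < n) i.+1%:R^-1 ^+ 2 +
    7 / 6 * (p%:R * \sum_(i < n) i.+1%:R^-1 ^+ 3) \in pideal p 2.
Proof.
move=> p_pr p3 p_n.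
pose f (j : nat) : rat := j%:R^-1 ^+ 2; pose g (j : nat) : rat := 2 * j%:R^-1 ^+ 3.
have fgp j : (0 < j < p)%N -> f (p - j)%N - (f j + p%:R * g j) \in pideal p 2.
  move=> jp; have pjp : (0 < p - j < p)%N by lia.
  (* This is the cofactor of p^2 in (p - j)^-2 - j^-2 - 2 p j^-3. *)
  have c : j%:R^-1 ^+ 3 * (p - j)%:R^-1 ^+ 2 * (3 * j%:R - 2 * p%:R) \in pint p.
    by rewrite !rpredM ?rpredX ?pint_inv_lt // rpredB ?rpredM ?rpred_nat.
  apply: mem_by_eq (pidealMr p_pr (pideal_self p_pr 2) c) _.
  have j0 : j%:R != 0 :> rat by rewrite pnatr_eq0; lia.
  have : (p - j)%:R != 0 :> rat by rewrite pnatr_eq0; lia.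
  rewrite /f /g natrB; last by lia.
  by move=> pj0; field; rewrite j0 pj0.
have half j : j.*2%:R^-1 = 2^-1 * j%:R^-1 :> rat.
  by rewrite -muln2 natrM invfM mulrC.
have f2 j : f j.*2 = 4^-1 * f j by rewrite /f half; move: (j%:R^-1 : rat) => x; field.
have g2 j : g j.*2 = 4^-1 / 2 * g j by rewrite /g half; move: (j%:R^-1 : rat) => x; field.
have [/= t1 t2] := half_range_sums p_pr p_n fgp f2 g2.
have two3 : 2 / 3 \in pint p by rewrite rpredM ?rpred_nat ?pint_inv3.
(* Eliminating T with c = 1/4 and V = 2 H_3 leaves 3/2 H_2 + 7/4 p H_3. *)
apply: mem_by_eq (pidealMl p_pr two3 (rpredB t2 t1)) _.
by rewrite /f /g -mulr_sumr; field.
Qed.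

(** * Bernoulli numbers and sums of powers *)

Lemma size_bern_seq (n : nat) : size (bern_seq n) = n.+1.
Proof. by elim: n => [|n IH] //=; rewrite size_rcons IH. Qed.

Lemma nth_bern_seq (n k : nat) : (k <= n)%N -> nth 0 (bern_seq n) k = bernoulli k.
Proof.
elim: n => [|n IH]; first by rewrite leqn0 => /eqP ->.
rewrite leq_eqVlt => /orP [/eqP -> //|lt_kn] /=.
by rewrite nth_rcons size_bern_seq lt_kn IH.
Qed.

Lemma bernoulliS (n : nat) :
  bernoulli n.+1 =
    - (\sum_(k < n.+1) ('C(n.+2, k))%:R * bernoulli k) / n.+2%:R.
Proof.
rewrite {1}/bernoulli /= nth_rcons size_bern_seq ltnn eqxx.
congr (- _ / _); apply: eq_bigr => k _.
by rewrite nth_bern_seq // -ltnS.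
Qed.

(** Sum the binomial expansion of (i + 1)^(m+1) - i^(m+1) over i < p; the left-hand sides
    telescope. *)
Lemma sum_powers_rec (p m : nat) :
  m.+1%:R * (\sum_(i < p) i%:R ^+ m) =
    p%:R ^+ m.+1 - \sum_(k < m) ('C(m.+1, k))%:R * (\sum_(i < p) i%:R ^+ k) :> rat.
Proof.
apply/eqP; rewrite eq_sym subr_eq eq_sym; apply/eqP.
under [X in _ + X]eq_bigr do rewrite mulr_sumr.
rewrite [X in _ + X]exchange_big mulr_sumr -big_split /=.
have telescope i : m.+1%:R * i%:R ^+ m + \sum_(k < m) ('C(m.+1, k))%:R * i%:R ^+ k
    = i.+1%:R ^+ m.+1 - i%:R ^+ m.+1 :> rat.
  rewrite -[i.+1%:R]natr1 (addrC i%:R) exprDn !big_ord_recr /=.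
  rewrite !expr1n binn binSn mulr1n !mul1r addrK mulr_natl addrC; congr (_ + _).
  by apply: eq_bigr => k _; rewrite expr1n mul1r mulr_natl.
under eq_bigr do rewrite telescope.
elim: p => [|p IH]; first by rewrite big_ord0 expr0n.
by rewrite big_ord_recr /= IH addrC subrK.
Qed.

(** For m > 0 the power sums obey the recursion of the p B_m up to p^(m+1), which lies in (p^2); the
    divisor m + 1 is less than p, hence invertible. *)
Lemma sum_powers_bernoulli (p m : nat) : prime p -> (m < p.-1)%N ->
  bernoulli m \in pint p /\
  \sum_(i < p) i%:R ^+ m - p%:R * bernoulli m \in pideal p 2.
Proof.
move=> p_pr; elim/ltn_ind: m => -[|m] IH mp.
  rewrite /bernoulli /= rpred1; split=> //.
  by rewrite mulr1 (eq_bigr (fun=> 1)) // sumr_const card_ord subrr rpred0.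
have inv_m : m.+2%:R^-1 \in pint p by rewrite pint_inv_lt //; lia.
have {}IH k : (k < m.+1)%N -> bernoulli k \in pint p /\
    \sum_(i < p) i%:R ^+ k - p%:R * bernoulli k \in pideal p 2.
  by move=> lt_km; apply: IH => //; lia.
split.
  rewrite bernoulliS rpredM // rpredN rpred_sum // => k _.
  by rewrite rpredM ?rpred_nat //; have [] := IH k (ltn_ord k).
have m2 : m.+2%:R != 0 :> rat by rewrite pnatr_eq0.
have ppow := pideal_le p_pr (isT : 2 <= m.+2)%N (pideal_self p_pr m.+2).
have sums : \sum_(k < m.+1) ('C(m.+2, k))%:R *
    (\sum_(i < p) i%:R ^+ k - p%:R * bernoulli k) \in pideal p 2.
  rewrite rpred_sum // => k _; rewrite pidealMl ?rpred_nat //.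
  by have [] := IH k (ltn_ord k).
apply: mem_by_eq (pidealMl p_pr inv_m (rpredB ppow sums)) _.
apply: (mulfI m2); rewrite mulrBr sum_powers_rec mulVKf // bernoulliS.
under [X in _ = _ - X]eq_bigr do rewrite mulrBr mulrCA.
by rewrite sumrB -mulr_sumr; move: (m.+2%:R : rat) m2 => x x0; field.
Qed.

(** The two pairings are applied to j^m with m = p - 3, where T is p B_m modulo p^2 and V is - m
    times the half-range sum X of the j^(p-4). *)
Lemma half_cubes (p n : nat) : prime p -> (3 < p)%N -> p = n.*2.+1 ->
  \sum_(i < n) i.+1%:R^-1 ^+ 3 + 2 * bernoulli (p - 3) \in pideal p 1.
Proof.
move=> p_pr p3 p_n; have n2 : (1 < n)%N by lia.
pose m := (p - 3)%N; have m_gt1 : (1 < m)%N by rewrite /m; lia.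
have m3 : (m + 3)%N = p by rewrite /m; lia.
have mE : m = (p - 4).+1 by rewrite /m; lia.
have [B_int sumB] := sum_powers_bernoulli p_pr (m := m) ltac:(rewrite /m; lia).
pose f (j : nat) : rat := j%:R ^+ m.
pose g (j : nat) : rat := - m%:R * j%:R ^+ (p - 4).
have fgp j : (0 < j < p)%N -> f (p - j)%N - (f j + p%:R * g j) \in pideal p 2.
  move=> jp; apply: mem_by_eq (expr_sub_pideal j (p - 4) p_pr) _.
  rewrite /f /g natrB; last by lia.
  have -> : p%:R - j%:R = - (j%:R - p%:R) :> rat by ring.
  rewrite exprNn -signr_odd (_ : odd m = false) ?expr0 ?mul1r -?mE; first by ring.
  by rewrite /m p_n; lia.
have f2 j : f j.*2 = 2 ^+ m * f j by rewrite /f -muln2 natrM exprMn mulrC.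
have g2 j : g j.*2 = 2 ^+ m / 2 * g j.
  by rewrite /g -muln2 natrM exprMn mE exprS; field.
have [/= t1 t2] := half_range_sums p_pr p_n fgp f2 g2.
have TE : \sum_(i < p) i%:R ^+ m = \sum_(i < p.-1) f i.+1 :> rat.
  rewrite -[in LHS](prednK (prime_gt0 p_pr)) big_ord_recl expr0n.
  by rewrite (_ : (m == 0)%N = false) ?add0r //; lia.
rewrite -{}TE in t1 t2.
set T := \sum_(i < p) _ in sumB t1 t2.
set U := \sum_(i < n) f _ in t1 t2.
set W := \sum_(i < n) i.+1%:R^-1 ^+ 3.
have VE : \sum_(i < n) g i.+1 = - m%:R * \sum_(i < n) i.+1%:R ^+ (p - 4).
  by rewrite mulr_sumr.
have cubes := half_cubes_pow p_pr p3 p_n; rewrite -/W in cubes.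
rewrite {}VE in t1 t2.
set X := \sum_(i < n) _ ^+ (p - 4) in cubes t1 t2.
have fermat2 : 4 * 2 ^+ m - 1 \in pideal p 1.
  apply: mem_by_eq (fermat_pideal (j := 2) p_pr _) _; first by lia.
  by rewrite (_ : p.-1 = m.+2) ?exprS ?mulrA -?natrM //; rewrite /m; lia.
have int2 k : 2 ^+ k \in pint p by rewrite rpredX ?rpred_nat.
have half_int : 2^-1 \in pint p := pint_inv2 p_pr p3.
have third_int : 3^-1 \in pint p := pint_inv3 p_pr p3.
have X_int : X \in pint p by rewrite rpred_sum // => i _; rewrite rpredX ?rpred_nat.
have m_int : m%:R \in pint p by rewrite rpred_nat.
have mp : m%:R + 3 \in pideal p 1.
  by rewrite -natrD m3; apply: (pideal_self p_pr 1).
(* 2^m times the first relation minus the second eliminates U; what remains is divisible by p, and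
   one factor p is cancelled. *)
have key : (2 ^+ m - 1) * bernoulli m + 2 ^+ m / 2 * m%:R * X \in pideal p 1.
  rewrite -(pideal_mulp p_pr).
  have z_int := int2 m; have c_int : 2 ^+ m - 1 \in pint p by rewrite rpredB ?rpred1.
  apply: mem_by_eq (rpredB (rpredB (pidealMl p_pr z_int t1) t2)
                           (pidealMl p_pr c_int sumB)) _.
  by field.
have four_int : 4 \in pint p by rewrite rpred_nat.
have e1 : bernoulli m + m%:R * X / 2 \in pint p by rewrite rpredD ?rpredM.
apply: mem_by_eq (rpredB (pidealMl p_pr (rpredM (rpred_nat (pint p) 2) third_int)
   (rpredB (pidealMr p_pr fermat2 e1) (pidealMl p_pr four_int key)))
   (rpredB cubes (pidealMr p_pr mp (rpredM X_int third_int)))) _.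
by field.
Qed.

(** * Binomial coefficients as products, and alternating sums *)

Lemma alt_binomial_prod (p k : nat) : (k < p)%N ->
  (-1) ^+ k * ('C(p.-1, k))%:R = \prod_(j < k) (1 + - (p%:R / j.+1%:R)) :> rat.
Proof.
elim: k => [|k IH] lt_kp; first by rewrite big_ord0 bin0 mulr1.
rewrite big_ord_recr /= -IH; last exact: ltnW.
have k1 : k.+1%:R != 0 :> rat by rewrite pnatr_eq0.
apply: (mulfI k1).
have /(congr1 (fun m => m%:R : rat)) := mul_bin_left p.-1 k.
rewrite !natrM natrB; last by lia.
have -> : p.-1%:R = p%:R - 1 :> rat by rewrite -subn1 natrB //; lia.
rewrite exprS mulrCA => ->.
by move: k1; rewrite -[k.+1]addn1 natrD => k1; field.
Qed.

Lemma central_binomial_odd_prod (n : nat) :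
  ('C(n.*2, n))%:R = 4 ^+ n * \prod_(j < n) (j.*2.+1%:R / j.*2.+2%:R) :> rat.
Proof.
elim: n => [|n IH]; first by rewrite big_ord0 mul1r.
have n1 : n.+1%:R != 0 :> rat by rewrite pnatr_eq0.
have b1 : (n.+1 * 'C(n.*2.+2, n.+1) = 2 * (n.*2.+1 * 'C(n.*2, n)))%N.
  have bin_mid : 'C(n.*2.+1, n) = 'C(n.*2.+1, n.+1).
    by rewrite -[RHS]bin_sub; [congr 'C(_, _)|]; lia.
  by rewrite binS bin_mid addnn -mul2n mulnCA -(mul_bin_diag n.*2.+1 n).
rewrite doubleS big_ord_recr /= exprSr mulrACA -IH.
apply: (mulfI n1); rewrite -natrM b1 !natrM (_ : n.*2.+2 = 2 * n.+1)%N; last by lia.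
by rewrite natrM; move: (n.+1%:R : rat) n1 => x x0; field.
Qed.

(** Each factor 1 - p/(2j) is - (p - 2j)/(2j), and the numerators p - 2j are the odd numbers below p
    in reverse order. *)
Lemma central_binomial_prod (n : nat) (p := n.*2.+1) :
  (-1) ^+ n * ('C(n.*2, n))%:R =
    2 ^+ n.*2 * \prod_(j < n) (1 + - (p%:R / j.*2.+2%:R)) :> rat.
Proof.
have term (j : 'I_n) : 1 + - (p%:R / j.*2.+2%:R) =
    -1 * ((rev_ord j).*2.+1%:R * j.*2.+2%:R^-1) :> rat.
  have j2 : j.*2.+2%:R != 0 :> rat by rewrite pnatr_eq0.
  have pE : p%:R = (rev_ord j).*2.+1%:R + j.*2.+2%:R :> rat.
    by rewrite -natrD; congr _%:R; rewrite /= /p; have := ltn_ord j; lia.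
  rewrite pE mulrDl divff //; move: (_ / _) => x; ring.
rewrite (eq_bigr _ (fun j _ => term j)) big_split /= prodr_const card_ord big_split /=.
rewrite central_binomial_odd_prod big_split /= -mul2n exprM (_ : 2 ^+ 2 = 4) //.
rewrite [LHS]mulrCA; congr (_ * (_ * (_ * _))).
by rewrite (reindex_inj rev_ord_inj).
Qed.

Lemma coef_exp_binomial (c : rat) (d N k : nat) :
  ((1 + c *: 'X^(d.+1)) ^+ N)`_(d.+1 * k) = c ^+ k * ('C(N, k))%:R.
Proof.
have term i : (1 ^+ (N - i) * (c *: 'X^(d.+1)) ^+ i *+ 'C(N, i))`_(d.+1 * k)
    = c ^+ i * ('C(N, i))%:R * (i == k)%:R.
  rewrite expr1n mul1r exprZn -exprM coefMn coefZ coefXn eqn_pmul2l // (eq_sym k).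
  by rewrite -[LHS]mulr_natr mulrAC.
rewrite exprDn coef_sum (eq_bigr _ (fun i _ => term (nat_of_ord i))).
have [le_kN|lt_Nk] := leqP k N.
  rewrite (bigD1 (Ordinal (le_kN : (k < N.+1)%N))) //= eqxx mulr1 big1 ?addr0 // => i.
  by rewrite -val_eqE /= => /negPf ->; rewrite mulr0.
rewrite bin_small // mulr0 big1 // => i _.
by rewrite ltn_eqF ?mulr0 //; have := ltn_ord i; lia.
Qed.

(** Compare the coefficients of X^(2n) in (1 - X^2)^(2n) = (1 - X)^(2n) (1 + X)^(2n). *)
Lemma alt_sum_sqr_binomial (n : nat) :
  \sum_(k < n.*2.+1) (-1) ^+ k * ('C(n.*2, k))%:R ^+ 2
    = (-1) ^+ n * ('C(n.*2, n))%:R :> rat.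
Proof.
rewrite -(coef_exp_binomial _ 1) mul2n.
have -> : 1 + -1 *: 'X^2 = (1 + -1 *: 'X^1) * (1 + 1 *: 'X^1) :> {poly rat}.
  by rewrite expr1 scale1r !scaleN1r; ring.
rewrite exprMn coefM; apply: eq_bigr => k _; have kn := ltn_ord k.
rewrite -[X in _`_X * _]mul1n -[X in _ * _`_X]mul1n !coef_exp_binomial expr1n mul1r.
by rewrite bin_sub -?mulrA //; lia.
Qed.

(** The coefficient of t_j is the sum of the (-1)^k for j < k <= 2n, which is 1 for odd j and 0 for
    even j. *)
Lemma alt_sum_telescope (n : nat) (t : nat -> rat) :
  \sum_(k < n.*2.+1) (-1) ^+ k * \sum_(j < k) t j = \sum_(j < n) t j.*2.+1.
Proof.
elim: n => [|n IH]; first by rewrite big_ord_recl !big_ord0 mulr0 addr0.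
rewrite doubleS 2!big_ord_recr /= IH [in RHS]big_ord_recr /=.
rewrite !exprS -mul2n exprM sqrrN !expr1n mul2n (big_ord_recr n.*2.+1) /=; ring.
Qed.

Lemma natr_bin2 (a : nat) : ('C(a, 2))%:R = a%:R * (a%:R - 1) / 2 :> rat.
Proof.
elim: a => [|a IH]; first by rewrite !mul0r.
by rewrite binS bin1 natrD IH -[a.+1]addn1 natrD; field.
Qed.

Lemma natr_bin3 (a : nat) :
  ('C(a, 3))%:R = a%:R * (a%:R - 1) * (a%:R - 2) / 6 :> rat.
Proof.
elim: a => [|a IH]; first by rewrite !mul0r.
by rewrite binS natrD IH natr_bin2 -[a.+1]addn1 natrD; field.
Qed.

(** The exponents (a - 1) k and k + k a have the same parity; this brings the given sum to the form
    S(a). *)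
Lemma signed_power (a k : nat) (c : rat) : (0 < a)%N ->
  (-1) ^+ ((a - 1) * k) * c ^+ a = (-1) ^+ k * ((-1) ^+ k * c) ^+ a.
Proof.
case: a => // a _; rewrite subn1 exprMn -exprM mulrA -exprD /=.
rewrite -signr_odd -[in RHS]signr_odd; congr ((-1) ^+ _ * _).
by rewrite oddD !oddM /= ; case: (odd a); case: (odd k).
Qed.

Lemma alt_sum_sign (n : nat) : \sum_(k < n.*2.+1) (-1) ^+ k = 1 :> rat.
Proof.
elim: n => [|n IH]; first by rewrite big_ord1.
rewrite doubleS 2!big_ord_recr /= IH !exprS; ring.
Qed.

Lemma alt_sum_power (p m a : nat) (u : nat -> rat) : prime p ->
  (forall k, (k < m)%N -> u k \in pideal p 1) ->
  \sum_(k < m) (-1) ^+ k * (1 + u k) ^+ a -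
    (\sum_(k < m) (-1) ^+ k + a%:R * (\sum_(k < m) (-1) ^+ k * u k) +
     ('C(a, 2))%:R * (\sum_(k < m) (-1) ^+ k * u k ^+ 2) +
     ('C(a, 3))%:R * (\sum_(k < m) (-1) ^+ k * u k ^+ 3)) \in pideal p 4.
Proof.
move=> p_pr u1; rewrite !mulr_sumr -!big_split -sumrB rpred_sum // => k _ /=.
have sign_int : (-1) ^+ k \in pint p by rewrite rpredX // rpredN rpred1.
apply: mem_by_eq (pidealMl p_pr sign_int (expr_trunc3 p_pr a (u1 k (ltn_ord k)))) _.
ring.
Qed.

(** * Logarithmic relations and their solution *)

Lemma log_relations (p n : nat) (u : nat -> rat) (v : rat)
    (D : rat := p%:R ^+ 3 * bernoulli (p - 3) / 12) :
  prime p -> (3 < p)%N -> p = n.*2.+1 ->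
  (forall k, (k < p)%N -> 1 + u k = \prod_(j < k) (1 + - (p%:R / j.+1%:R))) ->
  1 + v = \prod_(j < n) (1 + - (p%:R / j.*2.+2%:R)) ->
  [/\ forall k, (k < p)%N -> u k \in pideal p 1,
      v \in pideal p 1,
      \sum_(k < p) (-1) ^+ k * tlog (u k) - tlog v \in pideal p 4 &
      2 * tlog v - tlog (u n) - D \in pideal p 4].
Proof.
move=> p_pr p3 p_n uE vE.
pose f (j : nat) : rat := - (p%:R / j.+1%:R).
have f1 j : (j < p.-1)%N -> f j \in pideal p 1.
  move=> jp; rewrite rpredN (pidealMr p_pr (pideal_self p_pr 1)) //.
  by apply: pint_inv_lt => //; lia.
have logu k : (k < p)%N -> u k \in pideal p 1 /\
    tlog (u k) - \sum_(j < k) tlog (f j) \in pideal p 4.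
  move=> kp; have -> : u k = \prod_(j < k) (1 + f j) - 1 by rewrite -uE // addrAC subrr add0r.
  by apply: tlog_prod => // j jk; apply: f1; lia.
have [v1 logv] : v \in pideal p 1 /\
    tlog v - \sum_(j < n) tlog (f j.*2.+1) \in pideal p 4.
  have -> : v = \prod_(j < n) (1 + f j.*2.+1) - 1 by rewrite -vE addrAC subrr add0r.
  by apply: (tlog_prod p_pr p3 (f := fun j => f j.*2.+1)) => j jn; apply: f1; lia.
have sign_int k : (-1) ^+ k \in pint p by rewrite rpredX // rpredN rpred1.
split=> // [k kp||]; first by have [] := logu k kp.
  have tel := alt_sum_telescope n (fun j => tlog (f j)).
  have s : \sum_(k < p) (-1) ^+ k * (tlog (u k) - \sum_(j < k) tlog (f j)) \in pideal p 4.
    by apply: rpred_sum => k _; apply: pidealMl => //; have [] := logu k (ltn_ord k).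
  apply: mem_by_eq (rpredB s logv) _.
  under [in RHS]eq_bigr do rewrite mulrBr.
  by rewrite sumrB -tel -p_n; ring.
have np : (n < p)%N by lia.
have [_ logn] := logu n np.
have sq := half_squares p_pr p3 p_n; have cu := half_cubes p_pr p3 p_n.
set H2 := \sum_(i < n) _ in sq; set H3 := \sum_(i < n) _ in sq cu.
(* Termwise, 2 log(1 - p x/2) - log(1 - p x) has no linear term, and both its quadratic and its
   cubic coefficient in p x are 1/4. *)
have diff : 2 * \sum_(j < n) tlog (f j.*2.+1) - \sum_(j < n) tlog (f j) =
    p%:R ^+ 2 / 4 * (H2 + p%:R * H3).
  rewrite /H2 /H3 !mulr_sumr -sumrB -big_split mulr_sumr; apply: eq_bigr => j _ /=.
  rewrite /f (_ : j.*2.+2 = 2 * j.+1)%N; last by lia.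
  rewrite natrM invfM; move: (j.+1%:R^-1 : rat) => x.
  by rewrite /tlog; field.
have inv2 : 2^-1 \in pint p := pint_inv2 p_pr p3.
have inv3 : 3^-1 \in pint p := pint_inv3 p_pr p3.
have int2 : 2 \in pint p by rewrite rpred_nat.
have psq := pidealMr p_pr (pideal_self p_pr 2) (rpredM inv2 inv2).
(* H_2 + p H_3 is - p H_3 / 6 modulo p^2, and H_3 is - 2 B_{p-3} modulo p. *)
have h : H2 + p%:R * H3 - p%:R * bernoulli (p - 3) / 3 \in pideal p 2.
  apply: mem_by_eq (rpredB sq
    (pidealM p_pr (pideal_self p_pr 1) (pidealMr p_pr cu (rpredM inv2 inv3)))) _.
  by field.
apply: mem_by_eq (rpredD (rpredB (pidealMl p_pr int2 logv) logn)
                         (pidealM p_pr psq h)) _.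
rewrite mulrBr; move: diff; set A := \sum_(j < n) _; set B := \sum_(j < n) _ => diff.
have -> : B = 2 * A - p%:R ^+ 2 / 4 * (H2 + p%:R * H3) by rewrite -diff; ring.
by rewrite /D; field.
Qed.

Lemma tlog_ideal3 (p : nat) (D : rat) : prime p -> (3 < p)%N ->
  D \in pideal p 3 -> tlog D - D \in pideal p 4.
Proof.
move=> p_pr p3 D3; have Dp := pideal_pint p_pr D3.
have inv2 : 2^-1 \in pint p := pint_inv2 p_pr p3.
have inv3 : 3^-1 \in pint p := pint_inv3 p_pr p3.
apply: mem_by_eq (pidealMr p_pr (pideal_le p_pr (isT : 4 <= 3 + 3)%N
  (pidealM p_pr D3 D3)) (rpredB (rpredM Dp inv3) inv2)) _.
by rewrite /tlog; field.
Qed.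

(** Writing L for [tlog], L(y) = L(w) + L(v) and 2 L(v) - L(y) = D give L(v) = L(w) + D and L(y) = 2
    L(w) + D. Hence 1 + y is (1 + w)^2 (1 + D), where w D vanishes modulo p^4, and the last
    relation, with y - 2w as A_2, yields A_3. *)
Lemma log_system (p : nat) (v w y D A3 : rat) : prime p -> (3 < p)%N ->
  v \in pideal p 1 -> w \in pideal p 1 -> y \in pideal p 1 -> D \in pideal p 3 ->
  1 + y = (1 + w) * (1 + v) ->
  2 * tlog v - tlog y - D \in pideal p 4 ->
  w - (y - 2 * w) / 2 + A3 / 3 - tlog v \in pideal p 4 ->
  y - 2 * w - (w ^+ 2 + D) \in pideal p 4 /\
  A3 - (w ^+ 3 + 9 / 2 * D) \in pideal p 4.
Proof.
move=> p_pr p3 v1 w1 y1 D3 yE rel A3E.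
have D1 := pideal_le p_pr (isT : 1 <= 3)%N D3.
have int2 : 2 \in pint p by rewrite rpred_nat.
have int3 : 3 \in pint p by rewrite rpred_nat.
have inv2 : 2^-1 \in pint p := pint_inv2 p_pr p3.
have logy : tlog y - (tlog w + tlog v) \in pideal p 4.
  have <- : (1 + w) * (1 + v) - 1 = y by rewrite -yE; ring.
  exact: tlogM.
have logD := tlog_ideal3 p_pr p3 D3.
pose z := (1 + w) * (1 + w) - 1.
have zE : z = 2 * w + w ^+ 2 by rewrite /z; ring.
have logz : tlog z - (tlog w + tlog w) \in pideal p 4 := tlogM p_pr p3 w1 w1.
have wp := pideal_pint p_pr w1.
have z1 : z \in pideal p 1.
  by rewrite zE rpredD ?(pidealMl p_pr int2 w1) // (pidealMl p_pr wp w1).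
have logzD := tlogM p_pr p3 z1 D1.
have zD4 : z * D \in pideal p 4 := pidealM p_pr z1 D3.
pose y' := (1 + z) * (1 + D) - 1.
have y'E : y' = z + D + z * D by rewrite /y'; ring.
have y'1 : y' \in pideal p 1.
  have zD1 : z * D \in pideal p 1 := pideal_le p_pr (isT : 1 <= 4)%N zD4.
  by rewrite y'E; apply: rpredD zD1; apply: rpredD.
have yy' : y - y' \in pideal p 4.
  apply: (tlog_inj p_pr p3 y1 y'1).
  apply: mem_by_eq (rpredB (rpredB (rpredD (pidealMl p_pr int2 logy) rel) logz)
                           (rpredD logzD logD)) _.
  by rewrite -/y'; ring.
have y4 : y - 2 * w - (w ^+ 2 + D) \in pideal p 4.
  by apply: mem_by_eq (rpredD yy' zD4) _; rewrite y'E zE; ring.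
split=> //.
apply: mem_by_eq (rpredD (rpredD (pidealMl p_pr int3 A3E)
  (pidealMl p_pr int3 (rpredD logy rel))) (pidealMl p_pr (rpredM int3 inv2) y4)) _.
by rewrite /tlog; field.
Qed.

(** * The congruence for p > 3, and the case p = 3 *)

Lemma alt_binomial_sum_gt3 (p a : nat) : prime p -> (3 < p)%N -> (0 < a)%N ->
  \sum_(k < p) (-1) ^+ ((a - 1) * k) * ('C(p.-1, k))%:R ^+ a -
    (2 ^+ (a * p.-1) +
      a%:R * (a%:R - 1) * (3 * a%:R - 4) / 48 * p%:R ^+ 3 * bernoulli (p - 3))
    \in pideal p 4.
Proof.
move=> p_pr p3 a_gt0.
pose n := p./2; have p_n : p = n.*2.+1.
  rewrite -[LHS]odd_double_half; have [p2|-> //] := even_prime p_pr.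
  by rewrite p2 in p3.
pose x (k : nat) : rat := (-1) ^+ k * ('C(p.-1, k))%:R.
pose u k := x k - 1; have xu k : x k = 1 + u k by rewrite /u addrC subrK.
pose v : rat := \prod_(j < n) (1 + - (p%:R / j.*2.+2%:R)) - 1.
have uE k : (k < p)%N -> 1 + u k = \prod_(j < k) (1 + - (p%:R / j.+1%:R)).
  by move=> kp; rewrite -xu /x alt_binomial_prod.
have vE : 1 + v = \prod_(j < n) (1 + - (p%:R / j.*2.+2%:R)) by rewrite addrC subrK.
have [u1 v1 logsum rel] := log_relations p_pr p3 p_n uE vE.
pose w : rat := 2 ^+ p.-1 - 1.
have w1 : w \in pideal p 1 by apply: (fermat_pideal (j := 2)) => //; lia.
set D := _ / 12 in rel.
have D3 : D \in pideal p 3.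
  have [B_int _] := sum_powers_bernoulli p_pr (m := p - 3) ltac:(lia).
  have inv2 : 2^-1 \in pint p := pint_inv2 p_pr p3.
  have inv3 : 3^-1 \in pint p := pint_inv3 p_pr p3.
  apply: mem_by_eq (pidealMr p_pr (pideal_self p_pr 3)
    (rpredM B_int (rpredM inv3 (rpredM inv2 inv2)))) _.
  by rewrite /D; field.
have pn1 : p.-1 = n.*2 by rewrite p_n.
have np : (n < p)%N by lia.
have yE : 1 + u n = (1 + w) * (1 + v).
  rewrite -xu vE /x pn1 central_binomial_prod -p_n /w pn1; congr (_ * _).
  by rewrite addrC subrK.
have S0 : \sum_(k < p) (-1) ^+ k = 1 :> rat by rewrite p_n alt_sum_sign.
have S1 : \sum_(k < p) (-1) ^+ k * u k = w.
  have : \sum_(k < p) (-1) ^+ k * x k = 2 ^+ p.-1.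
    rewrite -natrX -[2%N]/(1 + 1)%N expnDn natr_sum prednK ?prime_gt0 //.
    apply: eq_bigr => k _; rewrite !exp1n !muln1 /x mulrA -exprD addnn -mul2n exprM.
    by rewrite sqrrN !expr1n mul1r.
  rewrite /w => <-; rewrite -[X in _ = _ - X]S0 -sumrB; apply: eq_bigr => k _; rewrite xu; ring.
(* Use u_k^2 = x_k^2 - 1 - 2 u_k. *)
have S2 : \sum_(k < p) (-1) ^+ k * u k ^+ 2 = u n - 2 * w.
  have xx : \sum_(k < p) (-1) ^+ k * x k ^+ 2 = x n.
    rewrite /x pn1 -alt_sum_sqr_binomial -p_n; apply: eq_bigr => k _.
    by rewrite exprMn -exprM mulnC exprM sqrrN !expr1n mul1r.
  have -> : u n = x n - 1 by [].
  rewrite -xx -S1 -[X in _ = _ - X - _]S0 mulr_sumr -!sumrB; apply: eq_bigr => k _; rewrite xu; ring.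
set S3 := \sum_(k < p) (-1) ^+ k * u k ^+ 3.
have logS : w - (u n - 2 * w) / 2 + S3 / 3 - tlog v \in pideal p 4.
  apply: mem_by_eq logsum _; congr (_ - _).
  rewrite -S2 -S1 /S3 !mulr_suml -sumrB -big_split; apply: eq_bigr => k _ /=.
  by rewrite /tlog; ring.
have [y4 z4] := log_system p_pr p3 v1 w1 (u1 n np) D3 yE rel logS.
have int_C k : ('C(a, k))%:R \in pint p by rewrite rpred_nat.
have := alt_sum_power a p_pr u1; rewrite S0 S1 S2 -/S3 => powS.
have -> : \sum_(k < p) (-1) ^+ ((a - 1) * k) * ('C(p.-1, k))%:R ^+ a =
    \sum_(k < p) (-1) ^+ k * (1 + u k) ^+ a.
  by apply: eq_bigr => k _; rewrite signed_power // -xu.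
have pow2 := expr_trunc3 p_pr a w1.
have -> : 2 ^+ (a * p.-1) = (1 + w) ^+ a by rewrite /w addrC subrK mulnC exprM.
(* The w-terms match the expansion of (1 + w)^a. What is left is (C(a,2) + 9/2 C(a,3)) D = a (a -
   1)(3a - 4) D / 4. *)
apply: mem_by_eq (rpredD (rpredB powS pow2)
  (rpredD (pidealMl p_pr (int_C 2%N) y4) (pidealMl p_pr (int_C 3%N) z4))) _.
by rewrite natr_bin2 natr_bin3 /D; field.
Qed.

(** The sum is 2 - (-2)^a; with -2 = 1 - 3 and 4 = 1 + 3, adding the two cubic expansions cancels
    the odd powers of 3. The final factor 1 is B_0. *)
Lemma alt_binomial_sum_eq3 (a : nat) : (0 < a)%N ->
  \sum_(k < 3) (-1) ^+ ((a - 1) * k) * ('C(2, k))%:R ^+ a -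
    (2 ^+ (a * 2) + a%:R * (a%:R - 1) * (3 * a%:R - 4) / 48 * 3 ^+ 3 * 1)
    \in pideal 3 4.
Proof.
move=> a_gt0; have pr3 : prime 3 by [].
have m3 : -3 \in pideal 3 1 by rewrite rpredN (pideal_self pr3 1).
have e1 := expr_trunc3 pr3 a m3; have e2 := expr_trunc3 pr3 a (pideal_self pr3 1).
rewrite (eq_bigr _ (fun k _ => signed_power _ _ a_gt0)).
have -> : \sum_(k < 3) (-1) ^+ k * ((-1) ^+ k * ('C(2, k))%:R) ^+ a =
    2 - (1 + -3) ^+ a :> rat.
  rewrite !big_ord_recl big_ord0 /= /bump /= addn0 addr0.
  have -> : 1 + -3 = -1 * 2 :> rat by ring.
  rewrite bin0 bin1 binn !mulr1n expr0 expr1 sqrrN !(mul1r, expr1n).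
  ring.
have -> : 2 ^+ (a * 2) = (1 + 3%:R ^+ 1) ^+ a :> rat by rewrite mulnC exprM.
have inv2 : 2^-1 \in pint 3 by apply: (pint_inv_nat (d := 2)).
(* 18 C(a,2) + 27 a (a - 1)(3a - 4)/48 equals 81 (C(a,3) + 2 C(a,2))/8. *)
have c : ('C(a, 3))%:R + 2 * ('C(a, 2))%:R \in pint 3.
  by rewrite rpredD ?rpredM ?rpred_nat.
rewrite -rpredN; apply: mem_by_eq (rpredD (rpredD e1 e2)
  (pidealMr pr3 (pideal_self pr3 4) (rpredM c (rpredX 3 inv2)))) _.
by rewrite natr_bin2 natr_bin3; field.
Qed.

Theorem theorem1p1 (p a : nat) (hp : prime p) (hodd : odd p) (ha : (0 < a)%N) :
  rat_cong_pow p 4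
    (\sum_(k < p) (-1) ^+ ((a - 1) * k) * (('C(p.-1, k))%:R) ^+ a)
    (2%:R ^+ (a * p.-1) +
       (a%:R * (a%:R - 1) * (3 * a%:R - 4)) / 48 * (p%:R) ^+ 3 * bernoulli (p - 3)).
Proof.
apply: rat_cong_powP => //.
have [p3|] := ltnP 3 p; first exact: alt_binomial_sum_gt3.
case: p hp hodd => [|[|[|[|p]]]] // _ _ _.
exact: alt_binomial_sum_eq3.
Qed.
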